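(* Let $(\mathcal{A},[\cdot,\cdot],N)$ be a Nijenhuis mock-Lie algebra, let $V$ be a vector space, $N_V:V\to V$ a linear map, and regard $(V,\mu,N_V)$ as a Nijenhuis mock-Lie algebra with $\mu(u,v)=0$ for all $u,v\in V$. Then two isomorphic abelian extensions $(\hat{\mathcal{A}},[\cdot,\cdot]_{\wedge_1},\hat N_1)$ and $(\hat{\mathcal{A}},[\cdot,\cdot]_{\wedge_2},\hat N_2)$ of $(\mathcal{A},[\cdot,\cdot],N)$ by $(V,\mu,N_V)$ give rise to the same cohomology class: the pairs $(\psi_1,\chi_1)$ and $(\psi_2,\chi_2)$ associated with sections of the first and of the second extension, respectively, are in the same cohomology class.
   Context: All vector spaces are over a field $K$ of characteristic zero. A mock-Lie algebra $(\mathcal{A},[\cdot,\cdot])$ is a vector space with a commutative bilinear map $[\cdot,\cdot]$ such that $[x,[y,z]]+[y,[z,x]]+[z,[x,y]]=0$. A Nijenhuis mock-Lie algebra $(\mathcal{A},[\cdot,\cdot],N)$ is a mock-Lie algebra with a linear map $N$ such that $[N(x),N(y)]+N^2([x,y])=N([N(x),y])+N([x,N(y)])$. Morphisms are linear maps commuting with brackets and with the operators. An abelian extension of $(\mathcal{A},[\cdot,\cdot],N)$ by $(V,\mu,N_V)$ is a Nijenhuis mock-Lie algebra $(\hat{\mathcal{A}},[\cdot,\cdot]_\wedge,\hat N)$ together with a short exact sequence of morphisms of Nijenhuis mock-Lie algebras $0\to V\xrightarrow{i}\hat{\mathcal{A}}\xrightarrow{p}\mathcal{A}\to0$; $V$ is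 identified with $i(V)$. Two abelian extensions, with maps $(i_1,p_1)$ and $(i_2,p_2)$, are isomorphic if there is an isomorphism $\xi$ of Nijenhuis mock-Lie algebras from the first to the second with $\xi\circ i_1=i_2$ and $p_2\circ\xi=p_1$. A section is a linear map $s:\mathcal{A}\to\hat{\mathcal{A}}$ with $p\circ s=\mathrm{id}_{\mathcal{A}}$. To a section $s$ one associates $\psi:\mathcal{A}\otimes\mathcal{A}\to V$, $\psi(x\otimes y)=[s(x),s(y)]_\wedge-s([x,y])$, and $\chi:\mathcal{A}\to V$, $\chi(x)=\hat N(s(x))-s(N(x))$. The map $\bar\rho_V:\mathcal{A}\to\mathrm{End}(V)$, $\bar\rho_V(x)(u)=[s(x),u]_\wedge$, does not depend on $s$ and is the same for isomorphic extensions. Two pairs $(\psi_1,\chi_1)$, $(\psi_2,\chi_2)$ of linear maps $\psi_k:\mathcal{A}\otimes\mathcal{A}\to V$, $\chi_k:\mathcal{A}\to V$ are in the same cohomology class (with coefficients in $V$) if there is a linear map $\gamma:\mathcal{A}\to V$ such that for all $x,y\in\mathcal{A}$ $$\psi_1(x\otimes y)-\psi_2(x\otimes y)=\bar\rho_V(y)\gamma(x)+\bar\rho_V(x)\gamma(y)-\gamma([x,y]),\qquad\chi_1(x)-\chi_2(x)=N_V(\gamma(x))-\gamma(N(x)).$$ *)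

(* Defs.v *)
From HB Require Import structures.
From mathcomp Require Import all_boot all_order all_algebra.

Set Implicit Arguments.
Unset Strict Implicit.
Unset Printing Implicit Defensive.

Import GRing.Theory.
Local Open Scope ring_scope.

(* The structure is a record over the carrier, not a canonical structure on    *)
(* it, because one vector space carries several of them at the same time.      *)
Record nijenhuis_mock_lie (K : fieldType) (A : lmodType K) := NijenhuisMockLie {
  bracket :> {bilinear A -> A -> A};
  nijop : {linear A -> A};
  bracketC : forall x y, bracket x y = bracket y x;
  bracket_jacobi : forall x y z,
    bracket x (bracket y z) + bracket y (bracket z x)
      + bracket z (bracket x y) = 0;
  nijopP : forall x y,
    bracket (nijop x) (nijop y) + nijop (nijop (bracket x y))
      = nijop (bracket (nijop x) y) + nijop (bracket x (nijop y))
}.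

Definition nml_morphism (K : fieldType) (A B : lmodType K)
    (SA : nijenhuis_mock_lie A) (SB : nijenhuis_mock_lie B)
    (f : {linear A -> B}) : Prop :=
  (forall x y, f (SA x y) = SB (f x) (f y))
  /\ (forall x, f (nijop SA x) = nijop SB (f x)).

Definition zero_bracket (K : fieldType) (V : lmodType K) (u v : V) : V := 0.

Section ZeroBracket.
Variables (K : fieldType) (V : lmodType K).

Fact zero_bracket_bilinear :
  bilinear_for *:%R *:%R (@zero_bracket K V : V -> V -> V).
Proof. by split=> u a x y; rewrite /= /zero_bracket scaler0 addr0. Qed.

HB.instance Definition _ := bilinear_isBilinear.Build K V V V *:%R *:%R
  (@zero_bracket K V) zero_bracket_bilinear.

Variable NV : {linear V -> V}.

Fact zero_bracketC (u v : V) : zero_bracket u v = zero_bracket v u.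
Proof. by []. Qed.

Fact zero_bracket_jacobi (u v w : V) :
  zero_bracket u (zero_bracket v w) + zero_bracket v (zero_bracket w u)
    + zero_bracket w (zero_bracket u v) = 0.
Proof. by rewrite /zero_bracket !addr0. Qed.

Fact zero_bracket_nijop (u v : V) :
  zero_bracket (NV u) (NV v) + NV (NV (zero_bracket u v))
    = NV (zero_bracket (NV u) v) + NV (zero_bracket u (NV v)).
Proof. by rewrite /zero_bracket !linear0. Qed.

Definition trivial_nml : nijenhuis_mock_lie V :=
  @NijenhuisMockLie K V (@zero_bracket K V) NV
    zero_bracketC zero_bracket_jacobi zero_bracket_nijop.

End ZeroBracket.

Record abelian_extension (K : fieldType) (A V : lmodType K)
    (SA : nijenhuis_mock_lie A) (NV : {linear V -> V}) (Ahat : lmodType K) :=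
  AbelianExtension {
  ext_alg :> nijenhuis_mock_lie Ahat;
  ext_i : {linear V -> Ahat};
  ext_p : {linear Ahat -> A};
  ext_i_morphism : nml_morphism (trivial_nml NV) ext_alg ext_i;
  ext_p_morphism : nml_morphism ext_alg SA ext_p;
  ext_i_inj : injective ext_i;
  ext_exact : forall e, ext_p e = 0 <-> exists v, ext_i v = e;
  ext_p_surj : forall x, exists e, ext_p e = x
}.

Definition ext_isomorphic (K : fieldType) (A V : lmodType K)
    (SA : nijenhuis_mock_lie A) (NV : {linear V -> V}) (Ahat1 Ahat2 : lmodType K)
    (X1 : abelian_extension SA NV Ahat1)
    (X2 : abelian_extension SA NV Ahat2) : Prop :=
  exists xi : {linear Ahat1 -> Ahat2},
    [/\ bijective xi,
        nml_morphism X1 X2 xi,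
        forall v, xi (ext_i X1 v) = ext_i X2 v
      & forall e, ext_p X2 (xi e) = ext_p X1 e].

Record ext_section (K : fieldType) (A V : lmodType K)
    (SA : nijenhuis_mock_lie A) (NV : {linear V -> V}) (Ahat : lmodType K)
    (X : abelian_extension SA NV Ahat) := ExtSection {
  sec_map :> {linear A -> Ahat};
  sec_mapK : forall x, ext_p X (sec_map x) = x
}.

(* A linear map A (x) A -> V is given by the corresponding bilinear map.       *)
Definition cochain (K : fieldType) (A V : lmodType K) : Type :=
  ({bilinear A -> A -> V} * {linear A -> V})%type.

Section AssociatedMaps.
Variables (K : fieldType) (A V : lmodType K) (SA : nijenhuis_mock_lie A).
Variables (NV : {linear V -> V}) (Ahat : lmodType K).
Variable X : abelian_extension SA NV Ahat.

Fact ext_ker_preimage (e : Ahat) : ext_p X e = 0 -> exists v, ext_i X v == e.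
Proof. by move/(ext_exact X e)=> [v <-]; exists v. Qed.

(* The identification of ker p = i(V) with V, that is, the inverse of i.       *)
Definition ext_to_V (e : Ahat) (e0 : ext_p X e = 0) : V :=
  xchoose (ext_ker_preimage e0).

Lemma ext_to_VK (e : Ahat) (e0 : ext_p X e = 0) : ext_i X (ext_to_V e0) = e.
Proof. exact/eqP/(xchooseP (ext_ker_preimage e0)). Qed.

Variable s : ext_section X.

Fact ext_psi_ker (x y : A) : ext_p X (X (s x) (s y) - s (SA x y)) = 0.
Proof. by rewrite linearB /= (ext_p_morphism X).1 !sec_mapK subrr. Qed.

Fact ext_chi_ker (x : A) : ext_p X (nijop X (s x) - s (nijop SA x)) = 0.
Proof. by rewrite linearB /= (ext_p_morphism X).2 !sec_mapK subrr. Qed.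

Fact ext_rho_ker (x : A) (u : V) : ext_p X (X (s x) (ext_i X u)) = 0.
Proof.
have iu0 : ext_p X (ext_i X u) = 0 by apply/(ext_exact X); exists u.
by rewrite (ext_p_morphism X).1 iu0 linear0r.
Qed.

Definition ext_psi (x y : A) : V := ext_to_V (ext_psi_ker x y).
Definition ext_chi (x : A) : V := ext_to_V (ext_chi_ker x).
Definition ext_rho (x : A) (u : V) : V := ext_to_V (ext_rho_ker x u).

Lemma ext_psiE x y : ext_i X (ext_psi x y) = X (s x) (s y) - s (SA x y).
Proof. exact: ext_to_VK. Qed.

Lemma ext_chiE x : ext_i X (ext_chi x) = nijop X (s x) - s (nijop SA x).
Proof. exact: ext_to_VK. Qed.

Lemma ext_rhoE x u : ext_i X (ext_rho x u) = X (s x) (ext_i X u).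
Proof. exact: ext_to_VK. Qed.

Fact ext_psi_bilinear : bilinear_for *:%R *:%R (ext_psi : A -> A -> V).
Proof.
split=> z a x y; apply: (@ext_i_inj _ _ _ _ _ _ X); rewrite linearP !ext_psiE /=.
- rewrite [s (a *: x + y)]linearP linearDl linearZl_LR.
  by rewrite [SA _ _]linearDl linearZl_LR [s (_ + _)]linearP /= scalerBr opprD addrACA.
- rewrite [s (a *: x + y)]linearP linearDr linearZr_LR.
  by rewrite [SA _ _]linearDr linearZr_LR [s (_ + _)]linearP /= scalerBr opprD addrACA.
Qed.

HB.instance Definition _ := bilinear_isBilinear.Build K A A V *:%R *:%R
  ext_psi ext_psi_bilinear.

Fact ext_chi_linear : linear ext_chi.
Proof.
move=> a x y; apply: (@ext_i_inj _ _ _ _ _ _ X); rewrite linearP !ext_chiE /=.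
rewrite [s (a *: x + y)]linearP [nijop SA _]linearP [s (_ + _)]linearP.
by rewrite linearP /= scalerBr opprD addrACA.
Qed.

HB.instance Definition _ := GRing.isLinear.Build K A V *:%R ext_chi ext_chi_linear.

Fact ext_rho_linear (x : A) : linear (ext_rho x).
Proof.
move=> a u v; apply: (@ext_i_inj _ _ _ _ _ _ X); rewrite linearP !ext_rhoE /=.
by rewrite linearP /= linearPr.
Qed.

HB.instance Definition _ (x : A) :=
  GRing.isLinear.Build K V V *:%R (ext_rho x) (ext_rho_linear x).

(* The argument s is only formal: see ext_action_section and                   *)
(* ext_action_isomorphic below.                                                *)
Definition ext_action (x : A) : {linear V -> V} := ext_rho x.

Definition ext_cochain : cochain A V :=
  (ext_psi : {bilinear A -> A -> V}, ext_chi : {linear A -> V}).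

End AssociatedMaps.

Lemma ext_action_isomorphic (K : fieldType) (A V : lmodType K)
    (SA : nijenhuis_mock_lie A) (NV : {linear V -> V}) (Ahat1 Ahat2 : lmodType K)
    (X1 : abelian_extension SA NV Ahat1) (X2 : abelian_extension SA NV Ahat2)
    (s1 : ext_section X1) (s2 : ext_section X2) :
  ext_isomorphic X1 X2 -> forall x, ext_action s1 x =1 ext_action s2 x.
Proof.
move=> [xi [_ [xiM _] xi_i p_xi]] x u; apply: (@ext_i_inj _ _ _ _ _ _ X2).
rewrite -xi_i !ext_rhoE xiM xi_i; apply/eqP; rewrite -subr_eq0 -linearBl.
have /(ext_exact X2)[v <-] : ext_p X2 (xi (s1 x) - s2 x) = 0.
  by rewrite linearB /= p_xi !sec_mapK subrr.
by rewrite -(ext_i_morphism X2).1 linear0.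
Qed.

Lemma ext_action_section (K : fieldType) (A V : lmodType K)
    (SA : nijenhuis_mock_lie A) (NV : {linear V -> V}) (Ahat : lmodType K)
    (X : abelian_extension SA NV Ahat) (s s' : ext_section X) (x : A) :
  ext_action s x =1 ext_action s' x.
Proof.
apply: ext_action_isomorphic; exists (idfun : {linear Ahat -> Ahat}).
by split=> //; exists id.
Qed.

Definition same_class (K : fieldType) (A V : lmodType K)
    (SA : nijenhuis_mock_lie A) (NV : {linear V -> V})
    (rho : A -> {linear V -> V}) (c1 c2 : cochain A V) : Prop :=
  exists gamma : {linear A -> V},
    (forall x y, c1.1 x y - c2.1 x y
       = rho y (gamma x) + rho x (gamma y) - gamma (SA x y))
    /\ (forall x, c1.2 x - c2.2 x = NV (gamma x) - gamma (nijop SA x)).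

(* Main.v *)
Require Import Defs.
From HB Require Import structures.
From mathcomp Require Import all_boot all_order all_algebra.

Set Implicit Arguments.
Unset Strict Implicit.
Unset Printing Implicit Defensive.

Import GRing.Theory.
Local Open Scope ring_scope.

(** The cochain of a section measures how far that section is from being a
    morphism, so two facts suffice. An isomorphism [xi] of extensions carries a
    section [s] to the section [xi \o s] of the other extension, and the cochain
    does not change ([ext_psi_transport], [ext_chi_transport]). Inside one
    extension, two sections differ by a linear map [gamma] into [ker p = V], and
    replacing one by the other changes the cochain by the coboundary of [gamma]
    ([same_class_sections]): the term quadratic in [gamma] vanishes because the
    bracket of [V] is zero. Hence the cochains of [s1] and of [xi \o s1] agree,
    and the latter is cohomologous to that of [s2]. *)

Lemma subrACA (U : zmodType) (a b c d : U) :
  (a - b) - (c - d) = (a - c) - (b - d).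
Proof. by rewrite opprD addrACA -opprD. Qed.

Section OneExtension.
Variables (K : fieldType) (A V : lmodType K) (SA : nijenhuis_mock_lie A).
Variables (NV : {linear V -> V}) (Ahat : lmodType K).
Variable X : abelian_extension SA NV Ahat.

Lemma ext_bracket_VV u v : X (ext_i X u) (ext_i X v) = 0.
Proof. by rewrite -(ext_i_morphism X).1 /= /zero_bracket linear0. Qed.

Section SectionDifference.
Variables s s' : ext_section X.

Fact section_diff_ker x : ext_p X (s x - s' x) = 0.
Proof. by rewrite linearB /= !sec_mapK subrr. Qed.

Definition section_diff x : V := ext_to_V (section_diff_ker x).

Lemma section_diffE x : ext_i X (section_diff x) = s x - s' x.
Proof. exact: ext_to_VK. Qed.

Fact section_diff_linear : linear section_diff.
Proof.
move=> a x y; apply: (@ext_i_inj _ _ _ _ _ _ X).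
rewrite linearP !section_diffE [s (_ + _)]linearP [s' (_ + _)]linearP.
by rewrite scalerBr opprD addrACA.
Qed.

HB.instance Definition _ :=
  GRing.isLinear.Build K A V *:%R section_diff section_diff_linear.

(** Write g = s - s'. Bilinearity gives
    [s x, s y] - [s' x, s' y] = [s x, g y] + [g x, s' y]. In the last term s' y
    may be replaced by s y, since [g x, g y] = 0, and commutativity makes it the
    action of y on g x. *)
Lemma same_class_sections :
  same_class SA NV (ext_action s) (ext_cochain s) (ext_cochain s').
Proof.
exists section_diff; split=> [x y|x] /=; apply: (@ext_i_inj _ _ _ _ _ _ X).
- rewrite !(linearB, linearD) /= !ext_psiE !ext_rhoE subrACA !section_diffE.
  congr (_ - _); rewrite (bracketC X (s y)) [RHS]addrC.
  have -> : X (s x - s' x) (s y) = X (s x - s' x) (s' y).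
    apply/eqP; rewrite -subr_eq0 -linearBr -!section_diffE.
    by rewrite ext_bracket_VV.
  by rewrite linearBr linearBl addrA subrK.
- rewrite !linearB /= !ext_chiE (ext_i_morphism X).2 !section_diffE.
  by rewrite subrACA [nijop X (_ - _)]linearB.
Qed.

End SectionDifference.
End OneExtension.

Section Transport.
Variables (K : fieldType) (A V : lmodType K) (SA : nijenhuis_mock_lie A).
Variables (NV : {linear V -> V}) (Ahat1 Ahat2 : lmodType K).
Variables (X1 : abelian_extension SA NV Ahat1).
Variables (X2 : abelian_extension SA NV Ahat2).
Variables (xi : {linear Ahat1 -> Ahat2}) (xiM : nml_morphism X1 X2 xi).
Hypothesis xi_i : forall v, xi (ext_i X1 v) = ext_i X2 v.
Hypothesis p_xi : forall e, ext_p X2 (xi e) = ext_p X1 e.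
Variable s : ext_section X1.

Fact transport_sectionK x : ext_p X2 ((xi \o s) x) = x.
Proof. by rewrite /= p_xi sec_mapK. Qed.

Definition transport_section : ext_section X2 := ExtSection transport_sectionK.

(** Since [xi] is a morphism over [A] that is the identity on [V], it carries the
    defect of [s] to the defect of [xi \o s] without changing it as an element
    of [V]. *)
Lemma ext_psi_transport x y : ext_psi transport_section x y = ext_psi s x y.
Proof.
apply: (@ext_i_inj _ _ _ _ _ _ X2).
by rewrite -[RHS]xi_i !ext_psiE linearB /= xiM.1.
Qed.

Lemma ext_chi_transport x : ext_chi transport_section x = ext_chi s x.
Proof.
apply: (@ext_i_inj _ _ _ _ _ _ X2).
by rewrite -[RHS]xi_i !ext_chiE linearB /= xiM.2.
Qed.

End Transport.

Theorem theorem3p10 (K : fieldType) (charK0 : [pchar K] =i pred0)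
    (A V : lmodType K) (SA : nijenhuis_mock_lie A) (NV : {linear V -> V})
    (Ahat : lmodType K) (X1 X2 : abelian_extension SA NV Ahat)
    (isoX : ext_isomorphic X1 X2)
    (s1 : ext_section X1) (s2 : ext_section X2) :
  same_class SA NV (ext_action s1) (ext_cochain s1) (ext_cochain s2).
Proof.
case: (isoX) => xi [_ xiM xi_i p_xi].
pose t := transport_section p_xi s1.
(* The coboundary for t is written with the action computed through t. *)
have actE := ext_action_isomorphic s1 t isoX.
have [g [psiE chiE]] := same_class_sections t s2.
exists g; split=> [x y|x].
- rewrite !actE -psiE /=.
  by rewrite (ext_psi_transport xiM xi_i p_xi).
- by rewrite -chiE /= (ext_chi_transport xiM xi_i p_xi).
Qed.
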